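(* Let $G=(V,E,c)$ be a finite connected weighted graph with positive edge conductances and effective-resistance matrix $R$, and for nonempty $T\subseteq V$ put $\rho_G(T)=\det R[T]/\operatorname{cof}R[T]$; for $|T|\ge2$ let $u_T$ be the unique maximizer of $u^{\mathsf T}R[T]u$ over all $u\in\mathbb{R}^T$ with $\mathbf 1^{\mathsf T}u=1$. Let $S\subseteq V$ with $|S|\ge2$, let $x\in V\setminus S$, put $A=R[S]$ and $b=(R_{sx})_{s\in S}\in\mathbb{R}^S$, and define $a=b^{\mathsf T}A^{-1}\mathbf 1$ and $\eta=b^{\mathsf T}A^{-1}b$. Then $$\rho_G(S\cup\{x\})=\rho_G(S)\quad\Longleftrightarrow\quad a=1\quad\Longleftrightarrow\quad u_{S\cup\{x\}}(x)=0.$$ More precisely, the marginal increment is $$\rho_G(S\cup\{x\})-\rho_G(S)=\rho_G(S)\,\rho_G(S\cup\{x\})\,\frac{(a-1)^2}{\eta}.$$ Moreover, the same condition (i.e. $a=1$) is equivalent to $$\sum_{s\in S}u_S(s)R_{xs}=\rho_G(S).$$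
   Context: $G=(V,E,c)$ is a finite connected undirected graph with edge conductances $c_e>0$; parallel edges are allowed, loops are omitted. With $N\in\mathbb{R}^{V\times E}$ the incidence matrix for an arbitrary orientation and $C=\operatorname{diag}(c_e)$, the weighted Laplacian is $L=NCN^{\mathsf T}$, and $L^+$ is its Moore--Penrose pseudoinverse. The effective resistance between $i,j\in V$ is $R_{ij}=(e_i-e_j)^{\mathsf T}L^+(e_i-e_j)$, and $R=(R_{ij})_{i,j\in V}$. For $T\subseteq V$, $R[T]$ is the principal submatrix of $R$ indexed by $T$. $\mathbf 1$ is the all-ones vector of the appropriate dimension. For a square matrix $M$, $\operatorname{cof}M=\sum_{i,j}(-1)^{i+j}\det M(i|j)$ is the sum of all cofactors, where $M(i|j)$ is $M$ with row $i$ and column $j$ deleted; for a $1\times1$ matrix it equals $1$. It is a fact that for $|T|\ge2$ the matrix $R[T]$ is invertible, $\operatorname{cof}R[T]\neq0$, $\rho_G(T)>0$, and the maximum of $u^{\mathsf T}R[T]u$ over $u\in\mathbb{R}^T$ with $\mathbf 1^{\mathsf T}u=1$ equals $\rho_G(T)$ and is attained at the unique vector $u_T=\rho_G(T)R[T]^{-1}\mathbf 1$. It is also a fact that $\eta>0$ for the $\eta$ defined in the claim. *)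

(* Defs.v *)
From HB Require Import structures.
From mathcomp Require Import all_boot all_order all_algebra.
From mathcomp Require Import boolp classical_sets reals.

Set Implicit Arguments.
Unset Strict Implicit.
Unset Printing Implicit Defensive.

Import Order.TTheory GRing.Theory Num.Theory.
Local Open Scope ring_scope.

Section MoorePenrose.
Variable F : realFieldType.
Implicit Types m n r : nat.

Definition is_moore_penrose m n (A : 'M[F]_(m, n)) (P : 'M[F]_(n, m)) : Prop :=
  [/\ A *m P *m A = A, P *m A *m P = P,
      (A *m P)^T = A *m P & (P *m A)^T = P *m A].

(* If A = B C is a full-rank factorisation, then
   A^+ = C^T (C C^T)^-1 (B^T B)^-1 B^T. *)
Definition pseudoinv m n (A : 'M[F]_(m, n)) : 'M[F]_(n, m) :=
  let B := col_base A in let C := row_base A in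
  C^T *m invmx (C *m C^T) *m invmx (B^T *m B) *m B^T.

Lemma row_free_gram_unit r n (C : 'M[F]_(r, n)) :
  row_free C -> C *m C^T \in unitmx.
Proof.
move=> fC; rewrite -row_free_unit -kermx_eq0; apply/rowV0P => v.
move=> /sub_kermxP vCC; apply/eqP; rewrite -(mulmx_free_eq0 _ fC).
have : (v *m C) *m (v *m C)^T = 0.
  by rewrite trmx_mul !mulmxA -(mulmxA v) vCC mul0mx.
move: (v *m C) => w /matrixP /(_ 0 0); rewrite !mxE => /eqP.
rewrite psumr_eq0 => [/allP sq0|i _]; last by rewrite [w^T _ _]mxE sqr_ge0.
apply/eqP/rowP => j; have := sq0 j (mem_index_enum j).
by rewrite [w^T _ _]mxE -expr2 sqrf_eq0 => /eqP ->; rewrite mxE.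
Qed.

Lemma full_rank_moore_penrose m n r (B : 'M[F]_(m, r)) (C : 'M[F]_(r, n)) :
  row_full B -> row_free C ->
  is_moore_penrose (B *m C)
    (C^T *m invmx (C *m C^T) *m invmx (B^T *m B) *m B^T).
Proof.
move=> fB fC; rewrite /is_moore_penrose.
have uC : C *m C^T \in unitmx by apply: row_free_gram_unit.
have uB : B^T *m B \in unitmx.
  rewrite -[in X in _ *m X](trmxK B); apply: row_free_gram_unit.
  by rewrite /row_free mxrank_tr.
set P := invmx (C *m C^T); set Q := invmx (B^T *m B).
have sP : P^T = P by rewrite /P trmx_inv trmx_mul trmxK.
have sQ : Q^T = Q by rewrite /Q trmx_inv trmx_mul trmxK.
have CP : C *m C^T *m P = 1%:M by rewrite mulmxV.
have QB : Q *m (B^T *m B) = 1%:M by rewrite mulVmx.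
have AP : B *m C *m (C^T *m P *m Q *m B^T) = B *m Q *m B^T.
  have -> : B *m C *m (C^T *m P *m Q *m B^T)
          = B *m (C *m C^T *m P) *m Q *m B^T by rewrite !mulmxA.
  by rewrite CP mulmx1.
have PA : C^T *m P *m Q *m B^T *m (B *m C) = C^T *m P *m C.
  have -> : C^T *m P *m Q *m B^T *m (B *m C)
          = C^T *m P *m (Q *m (B^T *m B)) *m C by rewrite !mulmxA.
  by rewrite QB mulmx1.
rewrite AP PA; split.
- have -> : B *m Q *m B^T *m (B *m C) = B *m (Q *m (B^T *m B)) *m C.
    by rewrite !mulmxA.
  by rewrite QB mulmx1.
- have -> : C^T *m P *m C *m (C^T *m P *m Q *m B^T)
          = C^T *m P *m (C *m C^T *m P) *m Q *m B^T by rewrite !mulmxA.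
  by rewrite CP mulmx1.
- by rewrite !trmx_mul trmxK sQ mulmxA.
- by rewrite !trmx_mul trmxK sP mulmxA.
Qed.

Lemma pseudoinvP m n (A : 'M[F]_(m, n)) : is_moore_penrose A (pseudoinv A).
Proof.
have := full_rank_moore_penrose (col_base_full A) (row_base_free A).
by rewrite mulmx_base => PA; exact: PA.
Qed.

Lemma moore_penrose_uniq m n (A : 'M[F]_(m, n)) (P Q : 'M[F]_(n, m)) :
  is_moore_penrose A P -> is_moore_penrose A Q -> P = Q.
Proof.
move=> [p1 p2 p3 p4] [q1 q2 q3 q4].
have eAP : A *m P = A *m Q.
  rewrite -p3 -[in LHS]q1 -(mulmxA (A *m Q)) trmx_mul p3 q3.
  by rewrite !mulmxA p1.
have ePA : P *m A = Q *m A.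
  rewrite -p4 -[in LHS]q1 -(mulmxA A) mulmxA trmx_mul q4 p4.
  by rewrite -mulmxA (mulmxA A) p1.
by rewrite -p2 -mulmxA eAP mulmxA ePA q2.
Qed.

End MoorePenrose.

(* Finite undirected loopless multigraph with positive conductances.  The
   ends of an edge are listed in an arbitrary order, which serves as the
   orientation; distinct edges may have the same ends. *)
Record wgraph (R : realType) := WGraph {
  vertex : finType;
  edge : finType;
  src : edge -> vertex;
  tgt : edge -> vertex;
  conductance : edge -> R;
  loopless : forall e, src e != tgt e;
  conductance_gt0 : forall e, 0 < conductance e }.

Section Resistance.
Variables (R : realType) (G : wgraph R).
Local Notation V := (vertex G).
Local Notation E := (edge G).
Implicit Types (i j x : V) (T : {set V}).

Definition adjacent : rel V := fun i j =>
  [exists e : E, ((src e == i) && (tgt e == j)) || ((src e == j) && (tgt e == i))].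

Definition connected : Prop := forall i j, connect adjacent i j.

(* Rows and columns indexed by a finite type or set go through its
   enumeration enum_val / enum_rank. *)
Definition incidence : 'M[R]_(#|V|, #|E|) :=
  \matrix_(k, l) ((enum_val k == src (enum_val l))%:R
                  - (enum_val k == tgt (enum_val l))%:R).

Definition laplacian : 'M[R]_#|V| :=
  incidence *m diag_mx (\row_l conductance (enum_val l)) *m incidence^T.

Definition basis_vec i : 'cV[R]_#|V| := delta_mx (enum_rank i) 0.

Definition eff_res i j : R :=
  ((basis_vec i - basis_vec j)^T *m pseudoinv laplacian
     *m (basis_vec i - basis_vec j)) 0 0.

Definition res_mx T : 'M[R]_#|T| :=
  \matrix_(k, l) eff_res (enum_val k) (enum_val l).

Definition res_col T x : 'cV[R]_#|T| := \col_k eff_res (enum_val k) x.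

Definition ones n : 'cV[R]_n := const_mx 1.

Definition cof n (M : 'M[R]_n) : R := \sum_i \sum_j cofactor M i j.

Definition rho T : R := \det (res_mx T) / cof (res_mx T).

Definition res_form T (u : 'cV[R]_#|T|) : R := (u^T *m res_mx T *m u) 0 0.

Definition is_maximizer T (u : 'cV[R]_#|T|) : Prop :=
  ((ones #|T|)^T *m u) 0 0 = 1 /\
  forall v : 'cV[R]_#|T|,
    ((ones #|T|)^T *m v) 0 0 = 1 -> res_form v <= res_form u.

(* The maximizer, chosen by description; 0 if there were none. *)
Definition opt_vec T : 'cV[R]_#|T| := xget 0 [set u | is_maximizer u]%classic.

Definition coord_at T x (xT : x \in T) (u : 'cV[R]_#|T|) : R :=
  u (enum_rank_in xT x) 0.

End Resistance.

(* Main.v *)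
Require Import Defs.
From mathcomp Require Import all_boot all_order all_algebra.
From mathcomp Require Import reals.
From mathcomp Require Import boolp classical_sets ring lra.

Set Implicit Arguments.
Unset Strict Implicit.
Unset Printing Implicit Defensive.

Import Order.TTheory GRing.Theory Num.Theory.
Local Open Scope ring_scope.

(** Writing [u] for the column of ones, [rho T] is the reciprocal of
    [u^T R[T]^-1 u], because the cofactor sum of an invertible matrix is its
    determinant times the sum of the entries of its inverse ([det_cof]).  So
    everything reduces to comparing [M^-1 u] with [A^-1 u], where [M] is [A]
    bordered by the column [b] and a zero diagonal entry.

    Let [t] be the entry of [M^-1 u] at [x].  Block elimination gives
    [M^-1 u = (A^-1 u - t A^-1 b, t)] with [t * eta = a - 1], and hence
    [1 / rho (S + x) = 1 / rho S - t (a - 1)] ([border_ones]).  This is the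
    increment formula.  As [rho] is positive and the optimal vector of [S + x]
    is [rho (S + x)] times [M^-1 u], the three conditions all say [t = 0].  The
    sum of the last claim is [rho S * a], by symmetry of the resistances.

    The graph enters only through one property of [R[T]]: it is symmetric with
    zero diagonal, and its quadratic form is negative on nonzero vectors whose
    entries add up to zero ([res_mx_distance]).  On such vectors the form of
    [R[T]] is [-2] times that of [L^+] on their extension by zero, and for a
    connected graph [L^+] is positive there: the form of [L^+] at [z] is that
    of [L] at [L^+ z], a sum of positive multiples of squared potential
    differences along the edges ([pinv_form_gt0]).

    The property alone gives invertibility, positivity of [rho], and the
    unique maximizer.  If [M w = c u] and [w] has sum 1, then any [v] of sum 1
    satisfies [v^T M v = c + (v - w)^T M (v - w)] ([equilibrium_form]), so [w]
    is the strict maximizer with value [c]; and evaluating at a coordinate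
    vector [v] other than [w], where the left side is zero, shows [c > 0]. *)

(** * Dot product of column vectors *)

Section Dot.
Variable R : realType.
Implicit Types n : nat.

Definition dot n (u v : 'cV[R]_n) : R := (u^T *m v) 0 0.

Lemma dotE n (u v : 'cV[R]_n) : dot u v = \sum_k u k 0 * v k 0.
Proof. by rewrite /dot mxE; apply: eq_bigr => k _; rewrite mxE. Qed.

Lemma dotC n (u v : 'cV[R]_n) : dot u v = dot v u.
Proof. by rewrite !dotE; apply: eq_bigr => k _; rewrite mulrC. Qed.

Lemma dotDr n (u v w : 'cV[R]_n) : dot u (v + w) = dot u v + dot u w.
Proof. by rewrite /dot mulmxDr mxE. Qed.

Lemma dotNr n (u v : 'cV[R]_n) : dot u (- v) = - dot u v.
Proof. by rewrite /dot mulmxN mxE. Qed.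

Lemma dotBr n (u v w : 'cV[R]_n) : dot u (v - w) = dot u v - dot u w.
Proof. by rewrite dotDr dotNr. Qed.

Lemma dotZr n (u v : 'cV[R]_n) a : dot u (a *: v) = a * dot u v.
Proof. by rewrite /dot -scalemxAr mxE. Qed.

Lemma dotBl n (u v w : 'cV[R]_n) : dot (u - v) w = dot u w - dot v w.
Proof. by rewrite dotC dotBr !(dotC w). Qed.

Lemma dot0r n (u : 'cV[R]_n) : dot u 0 = 0.
Proof. by rewrite /dot mulmx0 mxE. Qed.

Lemma dot_mulmxr m n (M : 'M[R]_(m, n)) u v :
  dot u (M *m v) = dot (M^T *m u) v.
Proof. by rewrite /dot trmx_mul trmxK mulmxA. Qed.

Lemma formE n (M : 'M[R]_n) (u v : 'cV[R]_n) :
  (u^T *m M *m v) 0 0 = dot u (M *m v).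
Proof. by rewrite /dot mulmxA. Qed.

Lemma dot_onesE n (u : 'cV[R]_n) : dot (ones R n) u = \sum_k u k 0.
Proof. by rewrite dotE; apply: eq_bigr => k _; rewrite mxE mul1r. Qed.

Lemma dot_ones_delta n (i : 'I_n) : dot (ones R n) (delta_mx i 0) = 1.
Proof.
rewrite dot_onesE (bigD1 i) //= big1 ?addr0; first by rewrite mxE !eqxx.
by move=> j /negPf nij; rewrite mxE nij.
Qed.

Lemma dot_delta n (M : 'M[R]_n) (i j : 'I_n) :
  dot (delta_mx i 0) (M *m delta_mx j 0) = M i j.
Proof. by rewrite /dot trmx_delta -rowE -colE !mxE. Qed.

End Dot.

(** * Strictly conditionally negative definite matrices *)

Section DistanceMatrix.
Variable R : realType.

(** The matrices of squared distances between affinely independent points of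
    a Euclidean space have these properties, and conversely. *)
Definition distance_mx n (M : 'M[R]_n) : Prop :=
  [/\ M^T = M, forall i, M i i = 0 &
      forall z : 'cV[R]_n,
        dot (ones R n) z = 0 -> z != 0 -> dot z (M *m z) < 0].

Variables (n : nat) (M : 'M[R]_n).
Hypotheses (dM : distance_mx M) (n_ge2 : (2 <= n)%N).

(** Expanding [(v - w)^T M (v - w)], the cross terms are [c] times sums of
    entries, which are all 1. *)
Lemma equilibrium_form (w v : 'cV[R]_n) c :
  M *m w = c *: ones R n -> dot (ones R n) w = 1 -> dot (ones R n) v = 1 ->
  dot v (M *m v) = c + dot (v - w) (M *m (v - w)).
Proof.
move=> Mw w1 v1; have [sM _ _] := dM.
have wM u : dot w (M *m u) = c * dot (ones R n) u.
  by rewrite dot_mulmxr sM Mw dotC dotZr dotC.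
by rewrite mulmxBr dotBl !dotBr !wM Mw !dotZr !(dotC _ (ones R n)) v1 w1; ring.
Qed.

(** The form vanishes at every coordinate vector, by the zero diagonal, and of
    two distinct coordinate vectors one differs from [w]; there the form falls
    strictly below [c]. *)
Lemma equilibrium_gt0 (w : 'cV[R]_n) c :
  M *m w = c *: ones R n -> dot (ones R n) w = 1 -> 0 < c.
Proof.
move=> Mw w1; have [_ dg neg] := dM.
have [i /negP ni] : exists i : 'I_n, ~ (delta_mx i 0 == w).
  pose i0 := Ordinal (ltnW n_ge2); pose i1 := Ordinal n_ge2.
  have [e0|] := eqVneq (delta_mx i0 0) w; last by move/negP; exists i0.
  exists i1 => /eqP e1; have := congr1 (fun u : 'cV_n => u i1 0) e0.
  by rewrite -e1 !mxE !eqxx /= => /eqP; rewrite eq_sym oner_eq0.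
have := equilibrium_form Mw w1 (dot_ones_delta R i).
rewrite dot_delta dg.
have : dot (delta_mx i 0 - w) (M *m (delta_mx i 0 - w)) < 0.
  by apply: neg; rewrite ?dotBr ?dot_ones_delta ?w1 ?subrr // subr_eq0.
lra.
Qed.

(** A kernel vector of sum 0 contradicts negativity.  One of nonzero sum can be
    scaled to an equilibrium with [c = 0], which is excluded as well. *)
Lemma distance_mx_unit : M \in unitmx.
Proof.
have [sM _ neg] := dM.
rewrite -row_free_unit -kermx_eq0; apply/rowV0P => v /sub_kermxP vM.
have Mu : M *m v^T = 0 by rewrite -sM -trmx_mul vM trmx0.
apply: trmx_inj; rewrite trmx0; apply/eqP/negPn/negP => u0.
have [s0|s0] := eqVneq (dot (ones R n) v^T) 0.
  by have := neg _ s0 u0; rewrite Mu dot0r ltxx.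
suff : 0 < 0 :> R by rewrite ltxx.
apply: (@equilibrium_gt0 ((dot (ones R n) v^T)^-1 *: v^T)).
  by rewrite -scalemxAr Mu scaler0 scale0r.
by rewrite dotZr mulVf.
Qed.

Lemma ones_inv_neq0 : dot (ones R n) (invmx M *m ones R n) != 0.
Proof.
have [sM _ neg] := dM; have uM := distance_mx_unit.
set u := _ *m _; apply/eqP => s0.
have Mu : M *m u = ones R n by rewrite mulKVmx.
have [u0|u0] := eqVneq u 0; last first.
  by have := neg _ s0 u0; rewrite Mu dotC s0 ltxx.
have /matrixP/(_ (Ordinal n_ge2) 0)/eqP := Mu.
by rewrite u0 mulmx0 !mxE eq_sym oner_eq0.
Qed.

(** The vector of sum 1 that [M] sends to a constant vector; it maximizes the
    quadratic form among vectors of sum 1. *)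
Definition equil : 'cV[R]_n :=
  (dot (ones R n) (invmx M *m ones R n))^-1 *: (invmx M *m ones R n).

Lemma equil_sum : dot (ones R n) equil = 1.
Proof. by rewrite dotZr mulVf ?ones_inv_neq0. Qed.

Lemma mul_equil :
  M *m equil = (dot (ones R n) (invmx M *m ones R n))^-1 *: ones R n.
Proof. by rewrite -scalemxAr mulKVmx ?distance_mx_unit. Qed.

Lemma ones_inv_gt0 : 0 < dot (ones R n) (invmx M *m ones R n).
Proof. by rewrite -invr_gt0 (equilibrium_gt0 mul_equil) ?equil_sum. Qed.

Lemma det_cof : \det M / cof M = (dot (ones R n) (invmx M *m ones R n))^-1.
Proof.
have uM := distance_mx_unit; have := uM; rewrite unitmxE unitfE => d0.
suff -> : cof M = \det M * dot (ones R n) (invmx M *m ones R n).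
  by rewrite invfM mulrA mulfV ?mul1r.
rewrite /invmx uM -scalemxAl dotZr mulrA mulfV ?mul1r // dot_onesE.
rewrite /cof exchange_big; apply: eq_bigr => j _.
by rewrite mxE; apply: eq_bigr => i _; rewrite !mxE mulr1.
Qed.

(** The equality case of the inequality carries the uniqueness of the
    maximizer. *)
Lemma equil_max (v : 'cV[R]_n) : dot (ones R n) v = 1 ->
  dot v (M *m v) <= dot equil (M *m equil) ?= iff (v == equil).
Proof.
move=> v1; have [_ _ neg] := dM.
rewrite (equilibrium_form mul_equil equil_sum v1) -(subr_eq0 v).
rewrite [X in _ <= X ?= iff _](_ : _ = (dot (ones R n) (invmx M *m ones R n))^-1);
  last by rewrite mul_equil dotZr (dotC equil) equil_sum mulr1.
have [->|d0] := eqVneq (v - equil) 0.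
  by rewrite mulmx0 dot0r addr0; apply/leifP.
apply/leifP; rewrite -subr_gt0 opprD addNKr oppr_gt0.
by apply: neg; rewrite // dotBr v1 equil_sum subrr.
Qed.

End DistanceMatrix.

(** With [K] the selected Gram matrix and [d] its diagonal, the matrix is
    [d 1^T + 1 d^T - 2 K]; the first two terms vanish on vectors of sum 0.  The
    selection [P] has orthonormal rows because [f] is injective, so [P^T]
    embeds those vectors into larger ones that are still nonzero of sum 0. *)
Lemma gram_distance_mx (R : realType) m n (Q : 'M[R]_n) (f : 'I_m -> 'I_n) :
  Q^T = Q ->
  (forall z, dot (ones R n) z = 0 -> z != 0 -> 0 < dot z (Q *m z)) ->
  injective f ->
  distance_mx (\matrix_(k, l) (Q (f k) (f k) + Q (f l) (f l)
                               - Q (f k) (f l) - Q (f l) (f k))).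
Proof.
move=> sQ Qgt0 f_inj; set D := \matrix_(_, _) _.
split=> [|i|z z0 nz]; first by apply/matrixP => k l; rewrite /D !mxE; ring.
  by rewrite /D mxE; ring.
pose P : 'M[R]_(m, n) := rowsub f 1%:M.
have PQ : P *m Q *m P^T = mxsub f f Q.
  rewrite -rowsubE -[LHS]trmxK trmx_mul trmxK -rowsubE.
  by apply/matrixP => k l; rewrite !mxE.
have P1 : P *m ones R _ = ones R _.
  by rewrite -rowsubE; apply/matrixP => k l; rewrite !mxE.
have PP : P *m P^T = 1%:M.
  by rewrite -rowsubE; apply/matrixP => k l; rewrite !mxE (inj_eq f_inj) eq_sym.
have zP : dot (ones R _) (P^T *m z) = 0 by rewrite dot_mulmxr trmxK P1.
have nzP : P^T *m z != 0.
  by apply: contra nz => /eqP e; rewrite -[z]mul1mx -PP -mulmxA e mulmx0.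
suff -> : dot z (D *m z) = - 2 * dot (P^T *m z) (Q *m (P^T *m z)).
  by rewrite mulNr oppr_lt0 mulr_gt0 ?ltr0n ?Qgt0.
pose d : 'cV[R]_m := \col_k Q (f k) (f k).
have -> : D = d *m (ones R _)^T + ones R _ *m d^T
              - (mxsub f f Q + mxsub f f Q).
  apply/matrixP => k l; rewrite /D !mxE !big_ord1 !mxE.
  have -> : Q (f l) (f k) = Q (f k) (f l) by rewrite -{1}sQ mxE.
  by ring.
have z0' : (ones R _)^T *m z = 0 by apply/matrixP => k l; rewrite !ord1 [RHS]mxE.
have zK : dot z (mxsub f f Q *m z) = dot (P^T *m z) (Q *m (P^T *m z)).
  by rewrite -PQ -!mulmxA dot_mulmxr.
rewrite mulmxBl !mulmxDl dotBr !dotDr zK -(mulmxA d) z0' mulmx0 dot0r.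
by rewrite -(mulmxA (ones R m)) (dot_mulmxr (ones R m)) z0' dotC dot0r; ring.
Qed.

(** * Moore-Penrose inverse of a symmetric matrix *)

(** The transpose satisfies the same Penrose conditions. *)
Lemma moore_penrose_sym (F : realFieldType) n (A P : 'M[F]_n) :
  A^T = A -> is_moore_penrose A P -> P^T = P.
Proof.
move=> sA mpP; apply: (moore_penrose_uniq _ mpP).
have [APA PAP sAP sPA] := mpP.
have AP : A *m P^T = P *m A by rewrite -sPA trmx_mul sA.
have PA : P^T *m A = A *m P by rewrite -sAP trmx_mul sA.
split; rewrite ?AP ?PA //.
- by have := congr1 trmx APA; rewrite !trmx_mul sA mulmxA ?AP ?PA.
- by have := congr1 trmx PAP; rewrite !trmx_mul sA mulmxA ?AP ?PA.
Qed.

Lemma moore_penrose_form (R : realType) n (A P : 'M[R]_n) (z : 'cV[R]_n) :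
  A^T = A -> is_moore_penrose A P -> dot z (P *m z) = dot (P *m z) (A *m (P *m z)).
Proof.
move=> sA mpP; have [_ PAP _ _] := mpP; have sP := moore_penrose_sym sA mpP.
by rewrite -{1}PAP -!mulmxA dot_mulmxr sP.
Qed.

(** For symmetric [A] the projections [P A] and [A P] coincide, so
    [A z = A (P A) z = A (A P z)]. *)
Lemma moore_penrose_ker (R : realType) n (A P : 'M[R]_n) (z : 'cV[R]_n) :
  A^T = A -> is_moore_penrose A P -> A *m (P *m z) = 0 -> A *m z = 0.
Proof.
move=> sA mpP APz; have [APA _ _ sPA] := mpP; have sP := moore_penrose_sym sA mpP.
by rewrite -APA -!mulmxA (mulmxA P) -sPA trmx_mul sA sP -mulmxA APz mulmx0.
Qed.

(** * Positivity of the Laplacian and of its pseudoinverse *)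

Section Laplacian.
Variables (R : realType) (G : wgraph R).
Hypothesis connG : connected G.
Local Notation V := (vertex G).
Local Notation L := (laplacian G).
Local Notation N := (incidence G).
Local Notation Q := (pseudoinv L).

Lemma laplacian_sym : L^T = L.
Proof. by rewrite /laplacian !trmx_mul trmxK tr_diag_mx mulmxA. Qed.

Lemma pinv_laplacian_sym : Q^T = Q.
Proof. exact: moore_penrose_sym laplacian_sym (pseudoinvP L). Qed.

Lemma laplacian_form (z : 'cV[R]_#|V|) :
  dot z (L *m z) =
  \sum_l conductance (enum_val l) * (N^T *m z) l 0 ^+ 2.
Proof.
rewrite /laplacian -!mulmxA dot_mulmxr dotE; apply: eq_bigr => l _.
by rewrite mul_diag_mx !mxE mulrCA expr2.
Qed.

Lemma laplacian_form_ge0 (z : 'cV[R]_#|V|) : 0 <= dot z (L *m z).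
Proof.
rewrite laplacian_form; apply: sumr_ge0 => l _.
by rewrite mulr_ge0 ?sqr_ge0 // ltW ?conductance_gt0.
Qed.

Lemma laplacian_form_eq0 (z : 'cV[R]_#|V|) :
  dot z (L *m z) = 0 -> N^T *m z = 0.
Proof.
rewrite laplacian_form => /eqP; rewrite psumr_eq0 => [/allP e0|l _]; last first.
  by rewrite mulr_ge0 ?sqr_ge0 // ltW ?conductance_gt0.
apply/colP => l; have := e0 l (mem_index_enum l).
by rewrite mulf_eq0 gt_eqF ?conductance_gt0 //= sqrf_eq0 => /eqP ->; rewrite mxE.
Qed.

Lemma laplacian_mul_eq0 (z : 'cV[R]_#|V|) : N^T *m z = 0 -> L *m z = 0.
Proof. by move=> Nz; rewrite /laplacian -!mulmxA Nz !mulmx0. Qed.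

Lemma incidence_tr_mulE (z : 'cV[R]_#|V|) (e : edge G) :
  (N^T *m z) (enum_rank e) 0 =
  z (enum_rank (src e)) 0 - z (enum_rank (tgt e)) 0.
Proof.
rewrite mxE; under eq_bigr => k _ do rewrite !mxE enum_rankK mulrBl.
rewrite sumrB; congr (_ - _).
  rewrite (bigD1 (enum_rank (src e))) //= enum_rankK eqxx mul1r big1 ?addr0 //.
  by move=> k /negPf nk; rewrite -(can_eq enum_rankK) enum_valK nk mul0r.
rewrite (bigD1 (enum_rank (tgt e))) //= enum_rankK eqxx mul1r big1 ?addr0 //.
by move=> k /negPf nk; rewrite -(can_eq enum_rankK) enum_valK nk mul0r.
Qed.

(** A potential without differences along edges is constant along paths, hence
    everywhere by connectedness. *)
Lemma potential_const (z : 'cV[R]_#|V|) i j :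
  N^T *m z = 0 -> z (enum_rank i) 0 = z (enum_rank j) 0.
Proof.
move=> Nz; have edgeE e : z (enum_rank (src e)) 0 = z (enum_rank (tgt e)) 0.
  by apply/eqP; rewrite -subr_eq0 -incidence_tr_mulE Nz mxE.
have /connectP [p pp ->] := connG i j.
elim: p i pp => //= k p IH i /andP[/existsP[e ik] /IH <-].
by case/orP: ik => /andP[/eqP <- /eqP <-].
Qed.

Lemma laplacian_form_gt0 (z : 'cV[R]_#|V|) :
  dot (ones R _) z = 0 -> z != 0 -> 0 < dot z (L *m z).
Proof.
move=> z0 nz; rewrite lt_def laplacian_form_ge0 andbT.
apply: contra nz => /eqP /laplacian_form_eq0 Nz; apply/eqP/colP => k.
have zk l : z l 0 = z k 0.
  by rewrite -(enum_valK l) -(enum_valK k); apply: potential_const.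
move: z0; rewrite dot_onesE (eq_bigr _ (fun l _ => zk l)) sumr_const mxE => /eqP.
by rewrite mulrn_eq0 card_ord gtn_eqF ?(leq_ltn_trans _ (ltn_ord k)) //= => /eqP.
Qed.

(** If the form vanishes at [z], then [L^+ z] has no potential differences, so
    [L L^+ z = 0] and [z] is in the kernel of [L], where only 0 has sum 0. *)
Lemma pinv_form_gt0 (z : 'cV[R]_#|V|) :
  dot (ones R _) z = 0 -> z != 0 -> 0 < dot z (Q *m z).
Proof.
have mpQ := pseudoinvP L => z0 nz.
rewrite (moore_penrose_form z laplacian_sym mpQ) lt_def laplacian_form_ge0 andbT.
apply/eqP => /laplacian_form_eq0 NQz.
have /(moore_penrose_ker laplacian_sym mpQ) Lz : L *m (Q *m z) = 0.
  exact: laplacian_mul_eq0.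
by have := laplacian_form_gt0 z0 nz; rewrite Lz dot0r ltxx.
Qed.

Lemma eff_resE (i j : V) (q := fun i j : V => Q (enum_rank i) (enum_rank j)) :
  eff_res i j = q i i + q j j - q i j - q j i.
Proof.
by rewrite /eff_res formE /basis_vec mulmxBr dotBl !dotBr !dot_delta /q; ring.
Qed.

Lemma eff_resC (i j : V) : eff_res i j = eff_res j i :> R.
Proof. by rewrite !eff_resE; ring. Qed.

Lemma eff_resxx (i : V) : eff_res i i = 0 :> R.
Proof. by rewrite eff_resE; ring. Qed.

Lemma res_mx_distance (T : {set V}) : distance_mx (res_mx T).
Proof.
pose f (k : 'I_#|T|) := enum_rank (enum_val k).
have f_inj : injective f by move=> k l /enum_rank_inj/enum_val_inj.
have := gram_distance_mx pinv_laplacian_sym pinv_form_gt0 f_inj.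
by congr distance_mx; apply/matrixP => k l; rewrite [LHS]mxE [RHS]mxE eff_resE.
Qed.

End Laplacian.

(** * Adding a vertex to the index set *)

Section Border.
Variables (R : realType) (G : wgraph R).
Hypothesis connG : connected G.
Local Notation V := (vertex G).

(** Vectors indexed by [T] are handled as restrictions of functions on all
    vertices, so that passing from [S] to [S + x] splits off one term of a sum
    over vertices, whatever the enumerations of the two sets. *)
Definition restrict (T : {set V}) (f : V -> R) : 'cV[R]_#|T| :=
  \col_k f (enum_val k).

Lemma restrict_surj (T : {set V}) (u : 'cV[R]_#|T|) :
  exists f, u = restrict T f.
Proof.
exists (fun v => \sum_k u k 0 * (enum_val k == v)%:R); apply/colP => l.
rewrite mxE (bigD1 l) //= eqxx mulr1 big1 ?addr0 // => k /negPf nkl.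
by rewrite (inj_eq enum_val_inj) nkl mulr0.
Qed.

Lemma dot_restrict (T : {set V}) f g :
  dot (restrict T f) (restrict T g) = \sum_(j in T) f j * g j.
Proof. by rewrite dotE [RHS]big_enum_val; apply: eq_bigr => k _; rewrite !mxE. Qed.

Lemma dot_ones_restrict (T : {set V}) f :
  dot (ones R _) (restrict T f) = \sum_(j in T) f j.
Proof. by rewrite dot_onesE [RHS]big_enum_val; apply: eq_bigr => k _; rewrite mxE. Qed.

Lemma res_mx_restrict (T : {set V}) f :
  res_mx T *m restrict T f =
  restrict T (fun i => \sum_(j in T) eff_res i j * f j).
Proof.
apply/colP => k; rewrite !mxE [RHS]big_enum_val.
by apply: eq_bigr => l _; rewrite !mxE.
Qed.

Lemma eq_restrict (T : {set V}) f g :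
  {in T, f =1 g} <-> restrict T f = restrict T g.
Proof.
split=> [fg|/colP fg i iT]; first by apply/colP => k; rewrite !mxE fg ?enum_valP.
by have := fg (enum_rank_in iT i); rewrite !mxE enum_rankK_in.
Qed.

Lemma opt_vecE (T : {set V}) : (2 <= #|T|)%N -> opt_vec T = equil (res_mx T).
Proof.
move=> cardT; have max := equil_max (res_mx_distance connG T) cardT.
have eq1 := equil_sum (res_mx_distance connG T) cardT.
have formT v : res_form v = dot v (res_mx T *m v) by rewrite /res_form formE.
apply: xget_unique => [|u [u1 umax]].
  by split=> // v v1; rewrite !formT (max v v1).
apply/eqP; rewrite -(max u u1).2 eq_le (max u u1).1 /=.
by rewrite -!formT umax.
Qed.

Variables (S : {set V}) (x : V).
Hypotheses (cardS : (2 <= #|S|)%N) (xS : x \notin S).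
Local Notation A := (res_mx S).
Local Notation b := (res_col S x).
Local Notation M := (res_mx (x |: S)).
Local Notation one := (ones R _).
Local Notation a := (dot b (invmx A *m one)).
Local Notation eta := (dot b (invmx A *m b)).

Let dA := res_mx_distance connG S.
Let dM := res_mx_distance connG (x |: S).
Let uA := distance_mx_unit dA cardS.

Let cardSx : (2 <= #|x |: S|)%N.
Proof. by rewrite cardsU1 xS (leq_trans cardS). Qed.

Let uM := distance_mx_unit dM cardSx.

(** The block form of the linear system for the bordered matrix; the corner
    entry is the zero resistance from [x] to itself. *)
Lemma border_mulP (f g : V -> R) :
  M *m restrict (x |: S) f = restrict (x |: S) g <->
  A *m restrict S f + f x *: b = restrict S g /\ dot b (restrict S f) = g x.
Proof.
have colE : b = restrict S (fun s => eff_res s x) by [].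
have lhsE : A *m restrict S f + f x *: b =
    restrict S (fun i => \sum_(j in x |: S) eff_res i j * f j).
  rewrite res_mx_restrict; apply/colP => k.
  by rewrite !mxE big_setU1 //= addrC mulrC.
have dotbE : dot b (restrict S f) = \sum_(j in x |: S) eff_res x j * f j.
  rewrite colE dot_restrict big_setU1 //= eff_resxx mul0r add0r.
  by apply: eq_bigr => j _; rewrite eff_resC.
rewrite lhsE dotbE res_mx_restrict; split=> [/eq_restrict fg|[/eq_restrict fg gx]].
  split; last by apply: fg; rewrite setU11.
  by apply/eq_restrict => i iS; apply: fg; rewrite setU1r.
by apply/eq_restrict => i /setU1P[-> //|]; apply: fg.
Qed.

(** Up to sign, [eta] is the Schur complement of [A] in the bordered matrix:
    the vector equal to [A^-1 b] on [S] and to [-1] at [x] is sent to the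
    vector that is 0 on [S] and [eta] at [x].  As that matrix is invertible,
    [eta] is nonzero. *)
Lemma eta_neq0 : eta != 0.
Proof.
apply/eqP => eta0; have [f fE] := restrict_surj (invmx A *m b).
pose f' i := if i == x then -1 else f i.
have f'S : restrict S f' = invmx A *m b.
  rewrite fE; apply/eq_restrict => i iS; rewrite /f'.
  by case: eqP iS xS => // -> ->.
have : M *m restrict (x |: S) f' = restrict (x |: S) (fun=> 0).
  apply/border_mulP; rewrite f'S mulKVmx // /f' eqxx scaleN1r subrr eta0.
  by split=> //; apply/colP => k; rewrite !mxE.
move/(canRL (mulKmx uM)).
have -> : restrict (x |: S) (fun=> 0) = 0 by apply/colP => k; rewrite !mxE.
rewrite mulmx0 => e0.
have /(_ x (setU11 x S)) : {in x |: S, f' =1 (fun=> 0)}.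
  by apply/eq_restrict; rewrite e0; apply/colP => k; rewrite !mxE.
by rewrite /f' eqxx => /eqP; rewrite oppr_eq0 oner_eq0.
Qed.

(** Block elimination of the bordered system with right-hand side of ones. *)
Lemma border_ones :
  let t := coord_at (setU11 x S) (invmx M *m one) in
  t * eta = a - 1 /\
  dot one (invmx M *m one) = dot one (invmx A *m one) - t * (a - 1).
Proof.
move=> t; have [f fE] := restrict_surj (invmx M *m one).
have tE : t = f x by rewrite /t /coord_at fE mxE enum_rankK_in ?setU11.
have onesE T : one = restrict T (fun=> 1) by apply/colP => k; rewrite !mxE.
have : M *m restrict (x |: S) f = restrict (x |: S) (fun=> 1).
  by rewrite -fE mulKVmx // onesE.
case/border_mulP; rewrite -onesE -tE => Af bf.
have fS : restrict S f = invmx A *m one - t *: (invmx A *m b).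
  by rewrite -Af mulmxDr mulKmx // -scalemxAr addrK.
have aE : dot one (invmx A *m b) = a.
  by have [sA _ _] := dA; rewrite dot_mulmxr trmx_inv sA dotC.
split; first by move: bf; rewrite fS dotBr dotZr => <-; ring.
rewrite fE dot_ones_restrict big_setU1 //= -tE -dot_ones_restrict fS.
by rewrite dotBr dotZr aE; ring.
Qed.

End Border.

Theorem corollary4p5 (R : realType) (G : wgraph R) (connG : connected G)
    (S : {set vertex G}) (cardS : (2 <= #|S|)%N)
    (x : vertex G) (xS : x \notin S) :
  let A := res_mx S in
  let b := res_col S x in
  let a := (b^T *m invmx A *m ones R #|S|) 0 0 in
  let eta := (b^T *m invmx A *m b) 0 0 in
  [/\ (rho (x |: S) = rho S <-> a = 1)
        /\ (a = 1 <-> coord_at (setU11 x S) (opt_vec (x |: S)) = 0),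
      rho (x |: S) - rho S = rho S * rho (x |: S) * ((a - 1) ^+ 2 / eta) &
      a = 1 <-> \sum_(s < #|S|) opt_vec S s 0 * eff_res x (enum_val s) = rho S].
Proof.
move=> A b a eta; rewrite /a /eta !formE.
have cardSx : (2 <= #|x |: S|)%N by rewrite cardsU1 xS (leq_trans cardS).
have dA := res_mx_distance connG S.
have dM := res_mx_distance connG (x |: S).
have eta0 := eta_neq0 connG cardS xS.
have [tE aM] := border_ones connG cardS xS.
have optx : coord_at (setU11 x S) (opt_vec (x |: S)) =
    rho (x |: S) * coord_at (setU11 x S) (invmx (res_mx (x |: S)) *m ones R _).
  by rewrite opt_vecE // /rho (det_cof dM) // /coord_at mxE.
have optS : \sum_(s < #|S|) opt_vec S s 0 * eff_res x (enum_val s) =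
    rho S * dot b (invmx A *m ones R _).
  rewrite opt_vecE // /rho (det_cof dA) // -dotZr dotC dotE.
  by apply: eq_bigr => s _; rewrite [b _ _]mxE eff_resC.
rewrite optx optS; move: tE aM eta0 (ones_inv_gt0 dM cardSx) (ones_inv_gt0 dA cardS).
rewrite /rho (det_cof dM) // (det_cof dA) //.
rewrite -/A -/b; move: (coord_at _ _) => t.
move: (dot b (invmx A *m b)) (dot b (invmx A *m ones R _)) => h a'.
move: (dot _ (invmx (res_mx (x |: S)) *m _)) (dot _ (invmx A *m _)) => al' al.
move=> tE alE h0 al'0 al0.
(* From here on [al] and [al'] are the reciprocals of [rho S] and of
   [rho (x |: S)], and [h], [a'] stand for [eta] and [a]. *)
have inc : al'^-1 - al^-1 = al^-1 * al'^-1 * ((a' - 1) ^+ 2 / h).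
  have -> : (a' - 1) ^+ 2 / h = al - al' by rewrite alE -tE; field.
  by field; rewrite !gt_eqF.
have a1E : al'^-1 = al^-1 <-> a' = 1.
  split=> [e|a1]; apply/eqP.
    move/eqP: inc; rewrite e subrr eq_sym !mulf_eq0 !invr_eq0 (gt_eqF al0).
    by rewrite (negPf h0) /= orbF orbb subr_eq0.
  by rewrite -subr_eq0 inc a1 subrr expr0n mul0r mulr0.
split=> //; first split=> //.
  split=> [a1|/eqP].
    have /eqP : t * h = 0 by rewrite tE a1 subrr.
    by rewrite mulf_eq0 (negPf h0) orbF => /eqP ->; rewrite mulr0.
  rewrite mulf_eq0 invr_eq0 (gt_eqF al'0) => /eqP t0.
  by apply/eqP; rewrite -subr_eq0 -tE t0 mul0r.
split=> [->|/eqP]; first by rewrite mulr1.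
by rewrite -subr_eq0 -{2}[al^-1]mulr1 -mulrBr mulf_eq0 invr_eq0 (gt_eqF al0) subr_eq0 => /eqP.
Qed.
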